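(* For every deterministic $H$-MBQC with input group $Q$, resource state $|\Psi\rangle$ and output function $o:Q\to\mathbb{Z}_2$, there is a 2-chain $f_{\rm e}\in C_2(E,E_0)$ (namely the 2-chain $f_{\rm e}$ associated with the measurement sequence $\mathcal{E}_{\rm e}$ for the trivial input) such that $$o(q)=\beta_\Psi(q f_{\rm e})\qquad\text{for all } q\in Q .$$
   Context: Observables. Fix a finite-dimensional Hilbert space. $\mathcal{O}$ is a set of observables (Hermitian operators with eigenvalues $\pm1$ only) with $A\in\mathcal{O}\Leftrightarrow -A\in\mathcal{O}$. A resolution of an observable $X$ in $\mathcal{O}$ is a product $X=A_1(A_2(\cdots(A_{K-1}A_K)))$, $K\ge 1$, $A_i\in\mathcal{O}$, such that with $B_i:=\prod_{l=i+1}^K A_l$ (in this order) $[A_i,B_i]=0$ for $i=1,\dots,K-1$. $\mathcal{I}$ is the set of all observables having a resolution in $\mathcal{O}$; it is closed under $A\mapsto -A$. $E$ is the set of classes $\{A,-A\}$, $A\in\mathcal{I}$; for each $a\in E$ a representative $T_a\in\mathcal{I}$ is fixed, so $\mathcal{I}=\{\pm T_a: a\in E\}$. $E_{\mathcal{O}}:=\{a\in E: T_a\in\mathcal{O}\}$. For $a\in E_{\mathcal{O}}$, $b\in E$ with $[T_a,T_b]=0$, $a\oplus b\in E$ and $\beta(a,b)\in\mathbb{Z}_2$ are defined by $T_{a\oplus b}=(-1)^{\beta(a,b)}T_aT_b$. Chain complex (coefficients $\mathbb{Z}_2$). $C_1(E)$ is freely generated by $[a]$, $a\in E$; $C_2(E)$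 is freely generated by the pairs $[a|b]$ for which $a\oplus b$ is defined; $\partial[a|b]=[a]+[b]+[a\oplus b]$. $\beta$ is regarded as a linear map $C_2(E)\to\mathbb{Z}_2$. For a linear $c:C_1(E)\to\mathbb{Z}_2$ (equivalently, a function on $E$), $dc(x):=c(\partial x)$. For $E_0\subset E$, $C_n(E,E_0):=C_n(E)/C_n(E_0)$, where $C_n(E_0)$ is spanned by the generators all of whose edges lie in $E_0$; $\partial_R$ is the induced boundary. Relative cochains are the cochains on $C_n(E)$ vanishing on $C_n(E_0)$. Input group. $Q$ is a finite group acting on $E$ such that $qa\in E_{\mathcal{O}}$ for $a\in E_{\mathcal{O}}$, and $q(a\oplus b)=qa\oplus qb$ whenever $a\oplus b$ is defined; so $Q$ acts on the chain groups. A sequence of distinct edges $a_1,\dots,a_n\in E_{\mathcal{O}}$ is fixed, $\mathcal{E}_{\rm e}=\{a_1,\dots,a_n\}$, such that $a_{\rm e}:=a_1\oplus(a_2\oplus\cdots\oplus(a_{n-1}\oplus a_n))$ is defined. $E_0:=\{qa_{\rm e}: q\in Q\}$, and $\mathcal{E}_{\rm e}\cap E_0=\emptyset$. With $b_i:=a_{i+1}\oplus(\cdots\oplus a_n)$ (so $b_{n-1}=a_n$), set $\tilde f_{\rm e}:=\sum_{i=1}^{n-1}[a_i|b_i]\in C_2(E)$, which satisfies $\partial\tilde f_{\rm e}=a_{\rm e}+\sum_{i}a_i$; $f_{\rm e}$ is the image of $\tilde f_{\rm e}$ in $C_2(E,E_0)$, and $\partial_R f_{\rm e}=\sum_i a_i$.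 Deterministic $H$-MBQC. On input $q\in Q$ the observables $T_{qa_1},\dots,T_{qa_n}$ are measured (projectively, sequentially) on the resource state $|\Psi\rangle$, giving outcomes $s(qa_i)\in\mathbb{Z}_2$ (measured eigenvalue $(-1)^{s(qa_i)}$), and the output is $o(q)=\sum_i s(qa_i)\bmod 2$. Deterministic means that $T_a|\Psi\rangle=(-1)^{s_\Psi(a)}|\Psi\rangle$ for all $a\in E_0$, for some $s_\Psi:E_0\to\mathbb{Z}_2$; then $o(q)$ is uniquely determined, $\prod_{i}T_{qa_i}|\Psi\rangle=(-1)^{o(q)}|\Psi\rangle$ (product in the order $1,\dots,n$). (An $H$-MBQC also carries a symmetry group $H$ acting on $\mathcal{I}$ by maps $h$ with $h(-A)=-h(A)$, $h(\mathcal{O})\subset\mathcal{O}$, $h(AB)=h(A)h(B)$ for commuting $A,B\in\mathcal{I}$ with $AB\in\mathcal I$, and preserving the set $\{(-1)^{o(q)}\prod_i T_{qa_i}: q\in Q\}$.) Let $\overline{s}_\Psi:E\to\mathbb{Z}_2$ be the extension of $s_\Psi$ by zero on $E\setminus E_0$. Then $\beta_\Psi:=\beta+d\overline{s}_\Psi$, a 2-cocycle vanishing on $C_2(E_0)$, hence defined on $C_2(E,E_0)$. *)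

(* Defs.v *)
From HB Require Import structures.
From mathcomp Require Import all_boot all_order all_algebra all_fingroup.
From mathcomp Require Import sesquilinear spectral generic_quotient ring_quotient.
From mathcomp Require Import boolp classical_sets reals complex.
From mathcomp.multinomials Require Import freeg.

Set Implicit Arguments.
Unset Strict Implicit.
Unset Printing Implicit Defensive.

Import Order.TTheory GRing.Theory Num.Theory.

Local Open Scope classical_set_scope.
Local Open Scope ring_scope.
Local Open Scope sesquilinear_scope.
Local Open Scope quotient_scope.

HB.instance Definition _ (K : nzRingType) (X : choiceType) (V : lmodType K)
    (f : X -> V) :=
  GRing.isZmodMorphism.Build {freeg X / K} V (fglift f) (lift_is_additive f).

Lemma signZ2D (C : numFieldType) (k l : 'Z_2) :
  (-1) ^+ (k + l)%R = (-1) ^+ k * (-1) ^+ l :> C.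
Proof. by rewrite /= modn2 signr_odd exprD. Qed.

Lemma signZ2_inj (C : numFieldType) (k l : 'Z_2) :
  (-1) ^+ k = (-1) ^+ l :> C -> k = l.
Proof.
case: k l => [[|[|//]] ?] [[|[|//]] ?] /=; rewrite ?expr0 ?expr1 => /eqP.
all: by rewrite ?(eq_sym 1) ?eqNr ?oner_eq0 // => _; apply/val_inj.
Qed.

Section Observables.
Variables (R : realType) (d : nat).
Local Notation mat := 'M[R[i]]_d.
Implicit Types (A B X : mat) (O : set mat) (s : seq mat).

Definition observable A : Prop :=
  A \is hermsymmx /\ forall x : R[i], eigenvalue A x -> x = 1 \/ x = -1.

(* The i-th entry (counted from 0) has to commute with the product of the
   entries that follow it; pairwise commutation is not required. *)
Definition resolution O X s : Prop :=
  [/\ s <> [::], forall A, A \in s -> O A,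
      forall i, (i.+1 < size s)%N ->
        comm_mx s`_i (\prod_(A <- drop i.+1 s) A)
    & X = \prod_(A <- s) A].

Definition inferable O : set mat :=
  [set X | observable X /\ exists s, resolution O X s].

Definition edges O : set (set mat) := [set [set A; - A] | A in inferable O].

(* The eigenprojector of A for the eigenvalue (-1)^k, for A an observable. *)
Definition eigenprojector A (k : 'Z_2) : mat :=
  2^-1 *: (1%:M + (-1) ^+ k *: A).

(* The unnormalized state after measuring As in turn, with outcomes ks; its
   squared norm is the probability of these outcomes. *)
Definition post_measurement (psi : 'cV[R[i]]_d) (As : seq mat)
    (ks : seq 'Z_2) : 'cV[R[i]]_d :=
  foldl (fun phi Ak => eigenprojector Ak.1 Ak.2 *m phi) psi (zip As ks).

Definition possible_outcomes (psi : 'cV[R[i]]_d) As (ks : seq 'Z_2) : Prop :=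
  size ks = size As /\ post_measurement psi As ks <> 0.

Lemma observable_sqr A : observable A -> A *m A = 1%:M.
Proof.
case=> /hermitian_normalmx/orthomx_spectralP defA eA; move: defA.
have := spectral_unit A.
move: (spectralmx A) (spectral_diag A) => P D Pu defA.
have Di i : D 0 i * D 0 i = 1.
  suff eD : eigenvalue A (D 0 i) by case: (eA _ eD) => ->; rewrite ?mulrNN mulr1.
  apply/eigenvalueP; exists (row i P).
    rewrite -row_mul defA !mulmxA mulmxV // mul1mx row_mul row_diag_mx.
    by rewrite -scalemxAl -rowE.
  apply/eqP => Pi0; have := congr1 (mulmx^~ (invmx P)) Pi0.
  rewrite -row_mul mulmxV // mul0mx => /rowP/(_ i).
  by rewrite !mxE eqxx => /eqP; rewrite oner_eq0.
rewrite defA !mulmxA mulmxK // -(mulmxA (invmx P)) mulmx_diag.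
suff Dsq : (\row_j (D 0 j * D 0 j)) = const_mx 1.
  by rewrite Dsq diag_const_mx mulmx1 mulVmx.
by apply/rowP => j; rewrite !mxE Di.
Qed.

Lemma observable_opp A : observable A -> observable (- A).
Proof.
move=> [hA eA]; split.
  move: hA; rewrite !is_hermitianmxE !expr0 !scale1r => /eqP {1}->.
  by rewrite linearN /= map_mxN.
move=> x /eigenvalueP[v vA v0].
have /eA[<-|/(congr1 -%R)] : eigenvalue A (- x).
- apply/eigenvalueP; exists v => //.
  by rewrite scaleNr -vA mulmxN opprK.
- by rewrite opprK; right.
- by rewrite !opprK; left.
Qed.

Lemma observable_mul A B :
  observable A -> observable B -> comm_mx A B -> observable (A *m B).
Proof.
move=> oA oB cAB; split.
  move: oA.1 oB.1; rewrite !is_hermitianmxE !expr0 !scale1r => /eqP hA /eqP hB.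
  by rewrite trmx_mul map_mxM -hA -hB cAB.
move=> x /eigenvalueP[v vAB v0].
have sq : (A *m B) *m (A *m B) = 1%:M.
  rewrite {1}cAB !mulmxA -(mulmxA B) observable_sqr // mulmx1.
  exact: observable_sqr.
have : (x * x) *: v = v.
  by rewrite -scalerA -vAB scalemxAl -vAB -mulmxA sq mulmx1.
move/eqP; rewrite -subr_eq0 -{2}[v]scale1r -scalerBl scaler_eq0 (negPf v0) orbF.
by rewrite subr_eq0 -expr2 sqrf_eq1 => /orP[]/eqP; [left|right].
Qed.

Lemma resolution_cons O A X s : O A -> comm_mx A X -> resolution O X s ->
  resolution O (A *m X) (A :: s).
Proof.
move=> OA cAX [s0 sO cs defX]; split => //.
- by move=> B; rewrite inE => /predU1P[->//|/sO].
- by case=> [_|i] /=; [rewrite drop0 -defX | exact: cs].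
- by rewrite big_cons -defX.
Qed.

Lemma inferable_opp O X : (forall A, O A <-> O (- A)) ->
  inferable O X -> inferable O (- X).
Proof.
move=> ON [oX [s [s0 sO cs defX]]]; split; first exact: observable_opp.
case: s s0 sO cs defX => // A s _ sO cs ->.
exists (- A :: s); split => //.
- move=> B; rewrite inE => /predU1P[->|Bs].
    by apply/ON; rewrite opprK; apply: sO; rewrite mem_head.
  by apply: sO; rewrite inE Bs orbT.
- case=> [|i] /= si; last exact: (cs i.+1).
  by apply/comm_mx_sym/comm_mxN/comm_mx_sym; exact: (cs 0%N).
- by rewrite !big_cons -mulNr.
Qed.

Lemma inferable_mul O A X : (forall B, O B -> observable B) ->
  O A -> inferable O X -> comm_mx A X -> inferable O (A *m X).
Proof.
move=> Oobs OA [oX [s rs]] cAX; split.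
  exact: observable_mul (Oobs _ OA) oX cAX.
by exists (A :: s); exact: resolution_cons.
Qed.

End Observables.

(* [edges obs] is the set of classes {A, -A}, coerced to a type; [rep a] is the
   fixed representative of the class a. *)
Record setting (R : realType) (d : nat) := Setting {
  obs : set 'M[R[i]]_d;
  obs_observable : forall A, obs A -> observable A;
  obs_opp : forall A, obs A <-> obs (- A);
  rep : edges obs -> 'M[R[i]]_d;
  rep_in : forall a : edges obs, (val a) (rep a) }.

Section Complex.
Variables (R : realType) (d : nat) (S : setting R d).
Local Notation mat := 'M[R[i]]_d.

Definition edge := set_type (edges (obs S)).
HB.instance Definition _ := Choice.on edge.
Implicit Types (a b : edge).

Definition T a : mat := rep a.

Definition EO : set edge := [set a | obs S (T a)].

Definition oplus_defined a b : Prop := EO a /\ comm_mx (T a) (T b).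

(* The class and the sign with T (oplus a b) = (-1)^(beta a b) T a T b, see
   [oplusP]; the values are irrelevant unless [oplus_defined a b]. *)
Definition oplus_beta a b : edge * 'Z_2 :=
  xget (b, 0 : 'Z_2)
    [set ck : edge * 'Z_2 | T ck.1 = (-1) ^+ ck.2 *: (T a *m T b)].
Definition oplus a b : edge := (oplus_beta a b).1.
Definition beta a b : 'Z_2 := (oplus_beta a b).2.

Lemma edge_inferable a : inferable (obs S) (T a).
Proof.
have := rep_in a; rewrite -/(T a); have /set_mem[A IA <-] := valP a.
by case=> ->//; apply: inferable_opp => //; exact: obs_opp.
Qed.

Lemma oplusP a b : oplus_defined a b ->
  T (oplus a b) = (-1) ^+ beta a b *: (T a *m T b).
Proof.
move=> [Oa cab]; rewrite /oplus /beta /oplus_beta.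
case: xgetP => [ck _ //|] nock.
have IX : inferable (obs S) (T a *m T b).
  apply: inferable_mul => //; first exact: obs_observable.
  exact: edge_inferable.
have EX : [set T a *m T b; - (T a *m T b)] \in edges (obs S).
  by apply/mem_set; exists (T a *m T b).
pose c : edge := exist (fun x => x \in edges (obs S)) _ EX.
case: (rep_in c) => Tc.
  by case: (nock (c, 0)); rewrite /= /T Tc expr0 scale1r.
by case: (nock (c, 1)); rewrite /= /T Tc expr1 scaleN1r.
Qed.

Definition C1 := {freeg edge / 'Z_2}.
Definition cell := {ab : edge * edge | `[< oplus_defined ab.1 ab.2 >]}.
Definition C2 := {freeg cell / 'Z_2}.

Definition gen1 a : C1 := << a >>.
(* The generator [a|b], or 0 if oplus a b is not defined. *)
Definition gen2 a b : C2 :=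
  if insub (a, b) is Some c then << (c : cell) >> else 0.

Definition cochain1 (c : edge -> 'Z_2) (x : C1) : 'Z_2 :=
  fglift (c : edge -> ('Z_2)^o) x.
Definition cochain2 (c : edge -> edge -> 'Z_2) (x : C2) : 'Z_2 :=
  fglift (fun ab : cell => c (val ab).1 (val ab).2 : ('Z_2)^o) x.

Definition boundary (x : C2) : C1 :=
  fglift (fun ab : cell => gen1 (val ab).1 + gen1 (val ab).2
                           + gen1 (oplus (val ab).1 (val ab).2)) x.

Definition coboundary (c : edge -> 'Z_2) (x : C2) : 'Z_2 :=
  cochain1 c (boundary x).

(* The chains of C_2(E_0). Coefficients are in Z_2, hence the linear span of
   the generators consists of their finite sums. *)
Definition cell_in (E0 : set edge) (ab : cell) : Prop :=
  [/\ E0 (val ab).1, E0 (val ab).2 & E0 (oplus (val ab).1 (val ab).2)].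
Definition sub2 (E0 : set edge) : {pred C2} := fun x =>
  `[< exists cs : seq cell, (forall c, c \in cs -> cell_in E0 c)
        /\ x = \sum_(c <- cs) << c >> >].

Lemma oppC2 (x : C2) : - x = x.
Proof.
have two0 : 2%:R = 0 :> 'Z_2 by apply/val_inj.
apply/eqP; rewrite eq_sym -addr_eq0 -mulr2n -(scaler_nat 2 x).
by rewrite two0 scale0r.
Qed.

Fact sub2_zmod_closed E0 : zmod_closed (sub2 E0).
Proof.
split; first by apply/asboolP; exists [::]; rewrite big_nil.
move=> x y /asboolP[cs [csE ->]] /asboolP[ds [dsE ->]].
rewrite oppC2; apply/asboolP; exists (cs ++ ds); rewrite big_cat; split=> // c.
by rewrite mem_cat => /orP[/csE|/dsE].
Qed.
HB.instance Definition _ E0 :=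
  GRing.isZmodClosed.Build C2 (sub2 E0) (sub2_zmod_closed E0).

Definition relC2 E0 := {ideal_quot (sub2 E0)}.
HB.instance Definition _ E0 := Quotient.on (relC2 E0).

(* The value on a relative chain of a cochain that vanishes on C_2(E_0). *)
Definition rel_cochain E0 (c : C2 -> 'Z_2) (x : relC2 E0) : 'Z_2 := c (repr x).

Lemma repr_piB E0 (x : C2) : repr (\pi_(relC2 E0) x) - x \in sub2 E0.
Proof. by rewrite Quotient.idealrBE reprK. Qed.

Lemma rel_cochain_pi E0 (c : C2 -> 'Z_2) (x : C2) :
  {morph c : y z / y - z} -> (forall y, y \in sub2 E0 -> c y = 0) ->
  rel_cochain c (\pi_(relC2 E0) x) = c x.
Proof.
by move=> cB c0; apply/eqP; rewrite -subr_eq0 -cB c0 // repr_piB.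
Qed.

Fixpoint nested_oplus a (s : seq edge) : edge :=
  if s is b :: s' then oplus a (nested_oplus b s') else a.
Fixpoint nested_oplus_defined a (s : seq edge) : Prop :=
  if s is b :: s' then
    nested_oplus_defined b s' /\ oplus_defined a (nested_oplus b s')
  else True.

Fixpoint nested_chain a (s : seq edge) : C2 :=
  if s is b :: s' then gen2 a (nested_oplus b s') + nested_chain b s' else 0.

End Complex.

Record input_action R d (S : setting R d) (Q : finGroupType) := InputAction {
  act :> Q -> edge S -> edge S;
  act1 : forall a, act 1%g a = a;
  actM : forall p q a, act (p * q)%g a = act p (act q a);
  act_EO : forall q a, EO a -> EO (act q a);
  act_oplus : forall q a b, oplus_defined a b ->
    oplus_defined (act q a) (act q b)
    /\ act q (oplus a b) = oplus (act q a) (act q b) }.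

Section Action.
Variables (R : realType) (d : nat) (S : setting R d) (Q : finGroupType).
Variable (u : input_action S Q).

Definition act2 (q : Q) (x : C2 S) : C2 S :=
  fglift (fun ab : cell S => gen2 (u q (val ab).1) (u q (val ab).2)) x.

Definition rel_act2 (E0 : set (edge S)) (q : Q) (x : relC2 E0) : relC2 E0 :=
  \pi_(relC2 E0) (act2 q (repr x)).

Lemma act2_gen2 q a b : oplus_defined a b ->
  act2 q (gen2 a b) = gen2 (u q a) (u q b).
Proof.
move=> dab; rewrite {1}/gen2 insubT /=; first exact/asboolP.
by move=> p; rewrite /act2 liftU scale1r.
Qed.

Lemma rel_act2_pi (E0 : set (edge S)) q (x : C2 S) :
  (forall a, E0 a -> E0 (u q a)) ->
  rel_act2 q (\pi_(relC2 E0) x) = \pi_(relC2 E0) (act2 q x).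
Proof.
move=> E0q; apply/eqP; rewrite -Quotient.idealrBE /act2 -(raddfB (fglift _)).
case/asboolP: (repr_piB E0 x) => cs [csE ->]; rewrite raddf_sum /=.
rewrite big_seq; apply: rpred_sum => ab /csE[Ea Eb Eab].
have /asboolP dab := valP ab; have [dq qab] := act_oplus u q dab.
rewrite liftU scale1r /gen2 insubT /=; first exact/asboolP.
move=> p; apply/asboolP; exists [:: Sub (u q (val ab).1, u q (val ab).2) p].
split; last by rewrite big_seq1.
move=> c; rewrite inE => /eqP->.
by split; rewrite /= -?qab; apply: E0q.
Qed.

End Action.

(* The measurement sequence is a_1 = [first], (a_2, ..., a_n) = [next]. *)
Record mbqc (R : realType) (d : nat) (Q : finGroupType) := MBQC {
  obs_setting :> setting R d;
  input : input_action obs_setting Q;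
  first : edge obs_setting;
  next : seq (edge obs_setting);
  seq_uniq : uniq (first :: next);
  seq_EO : forall a, a \in first :: next -> EO a;
  seq_defined : nested_oplus_defined first next;
  seq_disjoint : forall q,
    input q (nested_oplus first next) \notin first :: next;
  psi : 'cV[R[i]]_d;
  psi_unit : psi^t* *m psi = 1%:M }.

Section MBQC.
Variables (R : realType) (d : nat) (Q : finGroupType) (M : mbqc R d Q).
Local Notation mat := 'M[R[i]]_d.

Definition a_e : edge M := nested_oplus (first M) (next M).
Definition f_tilde : C2 M := nested_chain (first M) (next M).
Definition E0 : set (edge M) := range (fun q => input M q a_e).
Definition f_e : relC2 E0 := \pi_(relC2 E0) f_tilde.

Definition measured (q : Q) : seq mat :=
  [seq T (input M q a) | a <- first M :: next M].

Definition deterministic (s : E0 -> 'Z_2) : Prop :=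
  forall a : E0, T (val a) *m psi M = (-1) ^+ s a *: psi M.

Definition output_function (o : Q -> 'Z_2) : Prop :=
  forall (q : Q) (ks : seq 'Z_2),
    possible_outcomes (psi M) (measured q) ks -> o q = \sum_(k <- ks) k.

Definition output_operators (o : Q -> 'Z_2) : set mat :=
  [set (-1) ^+ o q *: \prod_(A <- measured q) A | q in setT].

(* An action on the inferable observables, given by a map on all matrices whose
   values elsewhere are irrelevant. *)
Record symmetry_action (H : groupType) (o : Q -> 'Z_2) (h : H -> mat -> mat)
    : Prop := SymmetryAction {
  sym_inferable : forall g A,
    inferable (obs M) A -> inferable (obs M) (h g A);
  sym1 : forall A, inferable (obs M) A -> h 1%g A = A;
  symM : forall f g A, inferable (obs M) A -> h (f * g)%g A = h f (h g A);
  sym_opp : forall g A, inferable (obs M) A -> h g (- A) = - h g A;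
  sym_obs : forall g A, obs M A -> obs M (h g A);
  sym_mul : forall g A B, inferable (obs M) A -> inferable (obs M) B ->
    comm_mx A B -> inferable (obs M) (A *m B) ->
    h g (A *m B) = h g A *m h g B;
  sym_output : forall g, h g @` output_operators o = output_operators o }.

Definition s_bar (s : E0 -> 'Z_2) (a : edge M) : 'Z_2 := oapp s 0 (insub a).

Definition beta_psi (s : E0 -> 'Z_2) (x : C2 M) : 'Z_2 :=
  cochain2 (@beta R d M) x + coboundary (s_bar s) x.

Lemma psi_neq0 : psi M != 0.
Proof.
apply/eqP => p0; have := psi_unit M; rewrite p0 mulmx0 => /matrixP/(_ 0 0)/eqP.
by rewrite !mxE eqxx eq_sym oner_eq0.
Qed.

Lemma act_E0 q a : E0 a -> E0 (input M q a).
Proof. by move=> [p _ <-]; exists (q * p)%g; rewrite ?actM. Qed.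

Lemma beta_psi_sub2 s x : deterministic s -> x \in sub2 E0 -> beta_psi s x = 0.
Proof.
move=> det /asboolP[cs [csE ->]].
rewrite /beta_psi /cochain2 /coboundary /cochain1 /boundary !raddf_sum -big_split /=.
rewrite big_seq big1 // => ab /csE[Ea Eb Eab] /=.
have /asboolP dab := valP ab.
rewrite !liftU !scale1r !raddfD /= /gen1 !liftU !scale1r.
have sE c : E0 c -> T c *m psi M = (-1) ^+ s_bar s c *: psi M.
  move=> Ec; rewrite /s_bar (insubT (fun c => c \in E0)) /=; first exact/mem_set.
  by move=> p; exact: (det (Sub c p)).
have := sE _ Eab; rewrite oplusP // -scalemxAl -mulmxA sE // -scalemxAr sE //.
rewrite !scalerA => /eqP; rewrite -subr_eq0 -scalerBl scaler_eq0.
rewrite (negPf psi_neq0) orbF subr_eq0.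
rewrite -!signZ2D => /eqP/signZ2_inj <-.
have cancel3 (i j k : 'Z_2) : i + (j + k + (i + k + j)) = 0.
  by case: i j k => [[|[|//]] ?] [[|[|//]] ?] [[|[|//]] ?]; apply/val_inj.
exact: cancel3.
Qed.

Lemma rel_beta_psi_pi s x : deterministic s ->
  rel_cochain (beta_psi s) (\pi_(relC2 E0) x) = beta_psi s x.
Proof.
move=> det; apply: rel_cochain_pi => [y z | y]; last exact: beta_psi_sub2.
rewrite /beta_psi /cochain2 /coboundary /cochain1 /boundary !raddfB /=.
by rewrite opprD addrACA.
Qed.

End MBQC.

Arguments E0 {R d Q} M _.
Arguments deterministic {R d Q} M s.

(* Main.v *)
(* Evaluating [beta_psi] on the chain [q f_e] gives the sign by which the ordered
   product of the [T (q a_i)] acts on [psi]: the [beta] part compares this product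
   with [T (q a_e)], and the coboundary part contributes the eigenvalue of
   [T (q a_e)], since no [q a_i] lies in [E_0].  This sign is the output: if
   [A_1 B_1] acts as a sign on a state and [A_1] commutes with [B_1], then after
   measuring [A_1] the operator [B_1] acts as a sign on the new state, and the two
   signs differ by the outcome. *)
Require Import Defs.
From mathcomp Require Import all_boot all_order all_algebra all_fingroup.
From mathcomp Require Import boolp classical_sets reals complex.
From mathcomp.multinomials Require Import freeg.

Set Implicit Arguments.
Unset Strict Implicit.
Unset Printing Implicit Defensive.

Import GRing.Theory Num.Theory.

Local Open Scope ring_scope.

Lemma signZ2_sqr (C : numFieldType) (k : 'Z_2) : (-1) ^+ k * (-1) ^+ k = 1 :> C.
Proof. by rewrite -expr2 sqrr_sign. Qed.

Lemma addZ2K (k l : 'Z_2) : k + (k + l) = l.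
Proof. by case: k l => [[|[|//]] ?] [[|[|//]] ?]; apply/val_inj. Qed.

(** * Outcomes of a sequential projective measurement *)

Section Measurement.
Variables (R : realType) (d : nat).
Implicit Types (A B : 'M[R[i]]_d) (phi : 'cV[R[i]]_d) (As : seq 'M[R[i]]_d).

Lemma sum_eigenprojectors A : eigenprojector A 0 + eigenprojector A 1 = 1%:M.
Proof.
rewrite /eigenprojector -scalerDr expr0 expr1 scale1r scaleN1r addrACA subrr.
by rewrite addr0 -mulr2n -[1%:M *+ 2]scaler_nat scalerA mulVf ?scale1r // pnatr_eq0.
Qed.

Lemma mul_eigenprojector A k : A *m A = 1%:M ->
  eigenprojector A k *m A = (-1) ^+ k *: eigenprojector A k.
Proof.
move=> AA; rewrite /eigenprojector -scalemxAl mulmxDl mul1mx -scalemxAl AA.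
rewrite [RHS]scalerA [_ * 2^-1]mulrC -scalerA; congr (_ *: _).
by rewrite scalerDr scalerA signZ2_sqr scale1r addrC.
Qed.

Lemma eigenprojector_comm A B k :
  comm_mx A B -> comm_mx (eigenprojector A k) B.
Proof.
move=> cAB; rewrite /comm_mx /eigenprojector -scalemxAl -scalemxAr.
by rewrite mulmxDl mulmxDr mul1mx mulmx1 -scalemxAl -scalemxAr cAB.
Qed.

(** The two eigenprojectors sum to the identity, so they cannot both annihilate a nonzero state.
    This matters because [output_function] constrains [o] only through outcomes that can occur. *)
Lemma possible_outcomes_ex phi As : phi <> 0 ->
  exists ks, possible_outcomes phi As ks.
Proof.
elim: As phi => [|A As IH] phi phi0; first by exists [::].
have [k /IH[ks [sks pks]]] : exists k, eigenprojector A k *m phi <> 0.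
  have [P0|P0] := eqVneq (eigenprojector A 0 *m phi) 0; last by exists 0; apply/eqP.
  exists 1 => P1; apply: phi0.
  rewrite -[phi]mul1mx -(sum_eigenprojectors A) mulmxDl.
  exact: etrans (congr2 +%R P0 P1) (addr0 0).
by exists (k :: ks); split; rewrite /= ?sks.
Qed.

(** The entries of [As] need not commute pairwise: that each commutes with the product of its
    successors is enough to carry the eigenvector equation past one projection. *)
Lemma possible_outcomes_sum phi As ks (c : 'Z_2) :
  (forall A, A \in As -> A *m A = 1%:M) ->
  (forall j, (j < size As)%N ->
     comm_mx As`_j (\prod_(A <- drop j.+1 As) A)) ->
  (\prod_(A <- As) A) *m phi = (-1) ^+ c *: phi ->
  possible_outcomes phi As ks -> \sum_(k <- ks) k = c.
Proof.
elim: As phi ks c => [|A As IH] phi [|k ks] c AsV cAs; rewrite ?big_nil.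
(* The empty product fixes the final state, which is nonzero, hence [c = 0]. *)
- rewrite mul1mx => + [_ /eqP phi0] => /eqP.
  rewrite -subr_eq0 -{1}[phi]scale1r -scalerBl scaler_eq0 (negPf phi0) orbF.
  by rewrite subr_eq0 => /eqP cE; apply: (@signZ2_inj R[i]); rewrite expr0.
- by move=> _ [].
- by move=> _ [].
rewrite !big_cons => AsE [[sks] pks].
have AA : A *m A = 1%:M by apply: AsV; rewrite mem_head.
have cA : comm_mx A (\prod_(B <- As) B) by have := cAs 0%N isT; rewrite /= drop0.
(* On the projected state the remaining product acts with sign [k + c]; adding the outcome [k] of
   [A] gives back [c]. *)
rewrite (IH (eigenprojector A k *m phi) ks (k + c)) ?addZ2K //.
- by move=> B BAs; apply: AsV; rewrite inE BAs orbT.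
- by move=> j; apply: (cAs j.+1).
have PA := mul_eigenprojector k AA; have PB := eigenprojector_comm k cA.
move: (eigenprojector A k) PA PB => P PA PB.
have PBE : P *m \prod_(B <- As) B = (-1) ^+ k *: (P *m (A *m \prod_(B <- As) B)).
  by rewrite (mulmxA P) PA -scalemxAl scalerA signZ2_sqr scale1r.
by rewrite mulmxA -PB PBE -scalemxAl -mulmxA AsE -scalemxAr scalerA -signZ2D.
Qed.

End Measurement.

(** * Cochains on the chain of a nested sum, and its translates under the input group *)

Section NestedChain.
Variables (R : realType) (d : nat) (S : setting R d).
Implicit Types (a : edge S) (s : seq (edge S)).

Lemma cochain2D (c : edge S -> edge S -> 'Z_2) x y :
  cochain2 c (x + y) = cochain2 c x + cochain2 c y.
Proof. by rewrite /cochain2 raddfD. Qed.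

Lemma boundaryD (x y : C2 S) : boundary (x + y) = boundary x + boundary y.
Proof. by rewrite /boundary raddfD. Qed.

Lemma cochain1D (c : edge S -> 'Z_2) x y :
  cochain1 c (x + y) = cochain1 c x + cochain1 c y.
Proof. by rewrite /cochain1 raddfD. Qed.

Lemma cochain1_gen1 (c : edge S -> 'Z_2) a : cochain1 c (gen1 a) = c a.
Proof. by rewrite /cochain1 liftU scale1r. Qed.

Lemma cochain2_gen2 (c : edge S -> edge S -> 'Z_2) a b :
  oplus_defined a b -> cochain2 c (gen2 a b) = c a b.
Proof.
move=> dab; rewrite /gen2 insubT /=; first exact/asboolP.
by move=> p; rewrite /cochain2 liftU scale1r.
Qed.

Lemma boundary_gen2 a b : oplus_defined a b ->
  boundary (gen2 a b) = gen1 a + gen1 b + gen1 (oplus a b).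
Proof.
move=> dab; rewrite /gen2 insubT /=; first exact/asboolP.
by move=> p; rewrite /boundary liftU scale1r.
Qed.

Lemma coboundary_gen2 (c : edge S -> 'Z_2) a b : oplus_defined a b ->
  coboundary c (gen2 a b) = c a + c b + c (oplus a b).
Proof.
by move=> dab; rewrite /coboundary boundary_gen2 // !cochain1D !cochain1_gen1.
Qed.

(** Each use of [oplusP] contributes one value of [beta], on exactly the cell that [nested_chain]
    adds at that stage. *)
Lemma T_nested_oplus a s : nested_oplus_defined a s ->
  T (nested_oplus a s) = (-1) ^+ cochain2 (@beta R d S) (nested_chain a s)
                         *: \prod_(b <- a :: s) T b.
Proof.
elim: s a => [|b s IH] a /=.
  by rewrite /cochain2 raddf0 expr0 scale1r big_seq1.
case=> /IH Tb dab; rewrite oplusP // big_cons Tb -scalemxAr scalerA -signZ2D.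
by rewrite cochain2D cochain2_gen2.
Qed.

(** The boundary telescopes modulo 2: each inner partial sum is the second edge of one cell and the
    [oplus] of the next. *)
Lemma coboundary_nested_chain (c : edge S -> 'Z_2) a s :
  nested_oplus_defined a s ->
  coboundary c (nested_chain a s) = c (nested_oplus a s) + \sum_(b <- a :: s) c b.
Proof.
elim: s a => [|b s IH] a /=.
  rewrite /coboundary /boundary /cochain1 !raddf0 big_seq1 => _.
  by rewrite -{2}[c a]addr0 addZ2K.
case=> /IH cb dab; rewrite /coboundary boundaryD cochain1D -!/(coboundary _ _).
rewrite coboundary_gen2 // cb [in RHS]big_cons.
rewrite [c a + _ + _]addrC -!addrA; congr (_ + (_ + _)).
exact: addZ2K.
Qed.

(** By [T_nested_oplus] the product of the later operators is [T] of a partial sum up to sign, and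
    [oplus_defined] gives commutation with the latter. *)
Lemma nested_oplus_comm a s j :
  nested_oplus_defined a s -> (j < (size s).+1)%N ->
  comm_mx [seq T b | b <- a :: s]`_j
          (\prod_(A <- drop j.+1 [seq T b | b <- a :: s]) A).
Proof.
elim: s a j => [|b s IH] a [|j] //=.
- by move=> _ _; rewrite big_nil; apply: comm_mx1.
- case=> db [_]; rewrite T_nested_oplus // -[T b :: _]/(map _ (b :: s)) big_map.
  move=> + _; set k := cochain2 _ _; move=> cab.
  have := comm_mx_sym cab; rewrite /comm_mx -scalemxAl -scalemxAr.
  by move=> /(congr1 ( *:%R ((-1) ^+ k))); rewrite !scalerA signZ2_sqr !scale1r.
- by case=> db _; rewrite ltnS; apply: IH.
Qed.

Variables (Q : finGroupType) (u : input_action S Q).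

Lemma act2D q (x y : C2 S) : act2 u q (x + y) = act2 u q x + act2 u q y.
Proof. by rewrite /act2 raddfD. Qed.

Lemma act_nested_oplus q a s : nested_oplus_defined a s ->
  nested_oplus_defined (u q a) (map (u q) s)
  /\ u q (nested_oplus a s) = nested_oplus (u q a) (map (u q) s).
Proof.
elim: s a => [|b s IH] a //= [/IH[dqb qb] /(act_oplus u q)[dqab ->]].
by rewrite -qb.
Qed.

(** This turns the translated chain into the chain of the translated sequence, so that the formulas
    above apply to every input. *)
Lemma act2_nested_chain q a s : nested_oplus_defined a s ->
  act2 u q (nested_chain a s) = nested_chain (u q a) (map (u q) s).
Proof.
elim: s a => [|b s IH] a /=; first by rewrite /act2 raddf0.
case=> db dab; rewrite act2D (IH b db) (act2_gen2 u q dab).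
by have [_ ->] := act_nested_oplus q db.
Qed.

End NestedChain.

Theorem theorem4 (R : realType) (d : nat) (Q : finGroupType) (M : mbqc R d Q)
    (o : Q -> 'Z_2) (H : groupType) (h : H -> 'M[R[i]]_d -> 'M[R[i]]_d)
    (s_psi : E0 M -> 'Z_2)
    (hsym : symmetry_action M o h)
    (hdet : deterministic M s_psi)
    (hout : output_function M o) :
  exists fe : relC2 (E0 M),
    fe = f_e M /\
    forall q : Q, o q = rel_cochain (beta_psi s_psi) (rel_act2 (input M) q fe).
Proof.
exists (f_e M); split=> // q.
(* [E0] is an orbit, hence stable under the action, so the class may be computed on [f_tilde]. *)
rewrite rel_act2_pi; last exact: act_E0.
rewrite rel_beta_psi_pi // act2_nested_chain; last exact: seq_defined.
have [dq qa] := act_nested_oplus (input M) q (seq_defined M).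
set a := input M q (first M) in dq qa *; set s := map _ _ in dq qa *.
have asE : a :: s = map (input M q) (first M :: Defs.next M) by [].
rewrite /beta_psi coboundary_nested_chain // [X in _ + (_ + X)]big1_seq; last first.
  move=> b; rewrite asE => /andP[_ /mapP[c cin ->]].
  (* If the translate of [c] by [q] were that of [a_e] by some [p], then [c] would be the translate
     of [a_e] by [q^-1 * p], against [seq_disjoint]. So [s_bar] takes its default value 0 here. *)
  rewrite /s_bar insubF //; apply/negP => /set_mem[p _ /(congr1 (input M q^-1%g))].
  rewrite /= -!Defs.actM mulVg Defs.act1 => pE.
  by have := seq_disjoint M (q^-1 * p)%g; rewrite -[nested_oplus _ _]/(a_e M) pE cin.
rewrite addr0 -qa.
have Eqa : E0 M (input M q (a_e M)) by exists q.
have sq : T (input M q (a_e M)) *m psi M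
          = (-1) ^+ s_bar s_psi (input M q (a_e M)) *: psi M.
  rewrite /s_bar (insubT (fun c => c \in E0 M)) /=; first exact/mem_set.
  by move=> p; exact: (hdet (Sub (input M q (a_e M)) p)).
have [ks pks] := possible_outcomes_ex (measured M q) (elimN eqP (psi_neq0 M)).
rewrite (hout q ks pks).
have mE : measured M q = [seq T b | b <- a :: s] by rewrite asE -map_comp.
apply: possible_outcomes_sum pks.
- move=> A /mapP[b bin ->]; apply: observable_sqr; apply: (@obs_observable _ _ M).
  exact/act_EO/seq_EO.
- by rewrite mE size_map => j; apply: nested_oplus_comm.
(* The eigenvalue sign is traded for the operator of the translated [a_e]; expanding this as a
   product yields the [beta] sign a second time, and the two cancel. *)
rewrite mE big_map signZ2D -scalerA -[nested_oplus _ _]/(a_e M) -sq.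
rewrite [input M q _]qa T_nested_oplus //.
by rewrite -scalemxAl scalerA signZ2_sqr scale1r.
Qed.
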